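(* Let $\Omega$ be a $\sigma$-compact metric space, $\nu$ a probability measure on the Borel $\sigma$-field of $\Omega$, $\mathcal{C}\in\mathbb{C}^{I_1\times\cdots\times I_N\times I_1\times\cdots\times I_N}$ a Hermitian tensor and $\tau\mapsto\mathcal{D}_\tau$ a continuous map from $\Omega$ into Hermitian tensors of the same size with $\sup\{\|\mathcal{D}_\tau\|:\tau\in\Omega\}<\infty$, all of Hermitian rank $r$. Then the following are equivalent: (i) $\vec\lambda(\mathcal{C})\prec\int_{\Omega^r}\vec\lambda(\mathcal{D}_\tau)\,d\nu^r(\tau)$; (ii) for every convex function $f:\mathbb{R}\to[0,\infty)$ and every unitarily invariant norm $\|\cdot\|_\rho$, $\|f(\mathcal{C})\|_\rho\le\int_\Omega\|f(\mathcal{D}_\tau)\|_\rho\,d\nu(\tau)$.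
   Context: Einstein product, conjugate transpose and Hermitian tensors: $(\mathcal{A}\star_N\mathcal{B})_{i,k}=\sum_j a_{i,j}b_{j,k}$ over multi-indices, $(\mathcal{A}^H)_{j,i}=\overline{a_{i,j}}$. A Hermitian tensor decomposes as $\mathcal{H}=\sum_{i=1}^r\lambda_i\mathcal{U}_i\otimes\mathcal{U}_i^H$ with real Hermitian eigenvalues and orthonormal $\mathcal{U}_i$; $r$ (minimal) is the Hermitian rank; $\vec\lambda(\mathcal{H})$ lists the Hermitian eigenvalues in decreasing order; $f(\mathcal{H})=\sum_i f(\lambda_i)\mathcal{U}_i\otimes\mathcal{U}_i^H$; $|\mathcal{A}|=(\mathcal{A}^H\star_N\mathcal{A})^{1/2}$; $\|\cdot\|$ is the operator norm. $\int_{\Omega^r}\vec\lambda(\mathcal{D}_\tau)d\nu^r(\tau)=\left(\int_\Omega\lambda_i(\mathcal{D}_\tau)d\nu(\tau)\right)_{i=1}^r$. For decreasingly ordered $\mathbf{x},\mathbf{y}\in\mathbb{R}^r$, $\mathbf{x}\prec\mathbf{y}$ means $\sum_{i=1}^kx_i\le\sum_{i=1}^ky_i$ for $k<r$ and equality for $k=r$. A unitarily invariant norm satisfies $\|\mathcal{U}\mathcal{H}\|_\rho=\|\mathcal{H}\mathcal{U}\|_\rho=\|\mathcal{H}\|_\rho$ for unitary $\mathcal{U}$ and $\|\mathcal{H}\|_\rho=\rho(\vec\lambda(|\mathcal{H}|))$ for a symmetric gauge function $\rho$. *)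

(* Defs.v *)
From HB Require Import structures.
From mathcomp Require Import all_boot all_order all_algebra.
From mathcomp Require Import all_classical all_reals all_analysis.
From mathcomp Require Import fingroup perm complex.
From Stdlib Require Import ClassicalEpsilon.

Set Implicit Arguments.
Unset Strict Implicit.
Unset Printing Implicit Defensive.

Import Order.TTheory GRing.Theory Num.Theory numFieldNormedType.Exports.
Local Open Scope ring_scope.
Local Open Scope classical_set_scope.

Definition mindex (N : nat) (I : 'I_N -> nat) : finType :=
  {dffun forall k : 'I_N, 'I_(I k)}.

Definition tensor (R : realType) N (I : 'I_N -> nat) := mindex I -> mindex I -> R[i].
Definition vtensor (R : realType) N (I : 'I_N -> nat) := mindex I -> R[i].

Definition ofR (R : realType) (x : R) : R[i] := Complex x 0.

Section Defs.
Variables (R : realType) (N : nat) (I : 'I_N -> nat).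
Local Notation T := (tensor R I).
Local Notation V := (vtensor R I).

Definition einstein (A B : T) : T := fun i k => \sum_j A i j * B j k.
Definition ctrans (A : T) : T := fun j i => (A i j)^*.
Definition hermitian (A : T) : Prop := ctrans A = A.
Definition outerH (U : V) : T := fun i j => U i * (U j)^*.
Definition orthonormal r (U : 'I_r -> V) : Prop :=
  forall a b : 'I_r, \sum_x (U a x)^* * U b x = (a == b)%:R.
Definition herm_sum r (l : 'I_r -> R) (U : 'I_r -> V) : T :=
  fun i j => \sum_(a < r) ofR (l a) * outerH (U a) i j.
Definition herm_decomp (H : T) r (l : 'I_r -> R) (U : 'I_r -> V) : Prop :=
  orthonormal U /\ H = herm_sum l U.
Definition herm_rank (H : T) (r : nat) : Prop :=
  hermitian H /\ (exists (l : 'I_r -> R) U, herm_decomp H l U) /\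
  (forall r' (l : 'I_r' -> R) U, herm_decomp H l U -> (r <= r')%N).

Definition decreasing r (l : 'I_r -> R) : Prop :=
  forall a b : 'I_r, (a <= b)%N -> l b <= l a.

Definition spec_data := {r : nat & (('I_r -> R) * ('I_r -> V))%type}.

Definition good_spec (H : T) (s : spec_data) : Prop :=
  let: existT r (l, U) := s in herm_rank H r /\ decreasing l /\ herm_decomp H l U.

Definition hspec (H : T) : spec_data :=
  epsilon (inhabits (existT _ 0%N ((fun _ => 0), (fun _ _ => 0)) : spec_data))
          (good_spec H).

Definition heig (H : T) : seq R :=
  let: existT r (l, _) := hspec H in [seq l a | a <- enum 'I_r].

Definition hfun (f : R -> R) (H : T) : T :=
  let: existT r (l, U) := hspec H in herm_sum (fun a => f (l a)) U.

Definition tabs (A : T) : T := hfun Num.sqrt (einstein (ctrans A) A).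

Definition tdim : nat := #|mindex I|.

Definition singvals (A : T) : 'I_tdim -> R := fun k => nth 0 (heig (tabs A)) k.

Definition sym_gauge (rho : ('I_tdim -> R) -> R) : Prop :=
  (forall x : 'I_tdim -> R, (exists k, x k != 0) -> 0 < rho x) /\
  (forall (c : R) x, rho (fun k => c * x k) = `|c| * rho x) /\
  (forall x y, rho (fun k => x k + y k) <= rho x + rho y) /\
  (forall (s : 'S_tdim) x, rho (fun k => x (s k)) = rho x) /\
  (forall (e : 'I_tdim -> bool) x, rho (fun k => (-1) ^+ e k * x k) = rho x).

Definition ui_norm (rho : ('I_tdim -> R) -> R) (A : T) : R := rho (singvals A).

Definition cabs2 (z : R[i]) : R := complex.Re z ^+ 2 + complex.Im z ^+ 2.
Definition vnorm (x : V) : R := Num.sqrt (\sum_i cabs2 (x i)).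
Definition opnorm (A : T) : R :=
  sup [set vnorm (fun i => \sum_j A i j * x j) | x in [set x : V | vnorm x <= 1]].

End Defs.

(* majorization x < y for (decreasingly ordered) vectors given as sequences *)
Definition majorized (R : realType) (x y : seq R) : Prop :=
  size x = size y /\
  (forall k, (k < size x)%N -> \sum_(i < k) nth 0 x i <= \sum_(i < k) nth 0 y i) /\
  \sum_(i < size x) nth 0 x i = \sum_(i < size x) nth 0 y i.

Definition convex_fun (R : realType) (f : R -> R) : Prop :=
  forall x y t : R, 0 <= t <= 1 -> f (t * x + (1 - t) * y) <= t * f x + (1 - t) * f y.

Definition sigma_compact_space (X : topologicalType) : Prop :=
  exists K : nat -> set X, (forall n, compact (K n)) /\ \bigcup_n K n = setT.

Definition tensor_continuous (R : realType) (X : topologicalType) N (I : 'I_N -> nat)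
  (D : X -> tensor R I) : Prop :=
  forall i j, continuous (fun t => complex.Re (D t i j)) /\ continuous (fun t => complex.Im (D t i j)).

(* Main.v *)
Require Import Defs.
From HB Require Import structures.
From mathcomp Require Import all_boot all_order all_algebra.
From mathcomp Require Import all_classical all_reals all_analysis.
From mathcomp Require Import fingroup perm complex.
From mathcomp Require Import ring lra.
Set Implicit Arguments.
Unset Strict Implicit.
Import Order.TTheory GRing.Theory Num.Theory numFieldNormedType.Exports.
Local Open Scope ring_scope.

(* (i) => (ii): with [f] convex and nonnegative, [x |-> rho (f x)] is a convex symmetric function on R^r. At the decreasing vector lambda(C) it has a subgradient, and by the rearrangement inequality the sorted subgradient is again one. Integrating the affine minorant along lambda(D_t) and summing by parts against the majorization hypothesis gives the bound; only the integrability of each lambda_i(D_t) is needed, never the measurability of the norm.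
(ii) => (i): take [f x = max (x + M) 0] with the Ky Fan [k]-norms, and [f x = max (M - x) 0] with the trace norm, where [M] bounds all the spectra.
The definitions choose a minimal spectral decomposition, so one needs that the nonzero eigenvalues of any decomposition agree, and that lambda_i(D_t) is Borel. Both follow from one dimension count comparing the numbers of eigenvalues above a level [c >= 0]. *)

(** * Summation by parts and the rearrangement inequality *)

(** Abel summation, one term at a time: once the last term cancels, the weight of a nonnegative
    partial sum only has to drop from one value of [g] to the next. *)
Lemma abel_sum_ge (R : realType) (n : nat) (g d : nat -> R) :
  (forall i, (i.+1 < n)%N -> g i.+1 <= g i) ->
  (forall k, (k < n)%N -> 0 <= \sum_(i < k) d i) ->
  g n.-1 * \sum_(i < n) d i <= \sum_(i < n) g i * d i.
Proof.
elim: n => [|n IH] hg hd; first by rewrite !big_ord0 mulr0.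
rewrite !big_ord_recr /= mulrDr lerD2r.
case: n IH hg hd => [|n] IH hg hd; first by rewrite !big_ord0 mulr0.
apply: le_trans (IH _ _) => [|i lin|k lkn]; first last.
- by apply: hd; rewrite ltnS ltnW.
- by apply: hg; rewrite ltnS ltnW.
by rewrite ler_wpM2r ?hd ?hg.
Qed.

(** A zero total makes the left side of [abel_sum_ge] vanish. Filtered prefix sums over ordinals are
    the form in which both the rearrangement inequality and majorization use it. *)
Lemma abel_sum_ge0 (R : realType) (r : nat) (g d : 'I_r -> R) :
  decreasing g ->
  (forall k, (k < r)%N -> 0 <= \sum_(i < r | (i < k)%N) d i) ->
  \sum_i d i = 0 ->
  0 <= \sum_i g i * d i.
Proof.
case: r g d => [|r] g d hg hd d0; first by rewrite big_ord0.
pose g' k := g (inord k); pose d' k := d (inord k).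
have -> : \sum_i g i * d i = \sum_(i < r.+1) g' i * d' i.
  by apply: eq_bigr => i _; rewrite /g' /d' inord_val.
have d'0 : \sum_(i < r.+1) d' i = 0.
  by rewrite -[RHS]d0; apply: eq_bigr => i _; rewrite /d' inord_val.
apply: le_trans (@abel_sum_ge R r.+1 g' d' _ _); first by rewrite d'0 mulr0.
- move=> i lir; apply: hg; rewrite !inordK //; exact: ltnW.
- move=> k lkr; rewrite (big_ord_widen _ d' (ltnW lkr)).
  apply: le_trans (hd k lkr) _; rewrite le_eqVlt; apply/orP; left; apply/eqP.
  by apply: eq_bigr => i _; rewrite /d' inord_val.
Qed.

Lemma card_ord_prefix (r k : nat) : (k <= r)%N -> #|[set i : 'I_r | (i < k)%N]| = k.
Proof.
move=> kr; rewrite cardsE -[RHS]card_ord -!sum1_card.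
by rewrite (big_ord_widen _ (fun=> 1%N) kr).
Qed.

(** Both sums have [#|A|] terms, so the last value [c] of the prefix may be subtracted throughout.
    Any subset sum of [y - c] is then at most the sum of all positive parts, which the prefix
    attains. *)
Lemma sum_subset_le_prefix (R : realType) (r : nat) (y : 'I_r -> R) (A : {set 'I_r}) :
  decreasing y -> \sum_(i in A) y i <= \sum_(i < r | (i < #|A|)%N) y i.
Proof.
move=> hy; set k := #|A|.
have kr : (k <= r)%N by rewrite -[r in (_ <= r)%N]card_ord max_card.
have [k0|kp] := posnP k.
  have /eqP : #|A| = 0 by [].
  by rewrite cards_eq0 => /eqP ->; rewrite big_set0 k0 big1.
have lk : (k.-1 < r)%N by rewrite prednK.
pose c := y (Ordinal lk).
have shift (B : {set 'I_r}) : \sum_(i in B) y i = \sum_(i in B) (y i - c) + c *+ #|B|.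
  by rewrite -sumr_const -big_split /=; apply: eq_bigr => i _; rewrite subrK.
have -> : \sum_(i < r | (i < k)%N) y i = \sum_(i in [set i : 'I_r | (i < k)%N]) y i.
  by apply: eq_bigl => i; rewrite inE.
rewrite !shift card_ord_prefix // lerD2r.
apply: (@le_trans _ _ (\sum_i Num.max (y i - c) 0)).
  rewrite big_mkcond; apply: ler_sum => i _.
  by case: ifP => _; rewrite le_max lexx ?orbT.
rewrite [leRHS]big_mkcond /=; apply: ler_sum => i _; rewrite inE.
case: ifPn => [lik|]; last rewrite -leqNgt => lki.
  by rewrite ge_max lexx subr_ge0 hy //= -ltnS prednK.
by rewrite ge_max lexx subr_le0 hy //= (leq_trans (leq_pred _)).
Qed.

Lemma exists_sorting_perm (R : realType) (r : nat) (g : 'I_r -> R) :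
  exists s : 'S_r, decreasing (fun i => g (s i)).
Proof.
pose leT := fun i j : 'I_r => g j <= g i.
pose t := sort leT (enum 'I_r).
have st : size t == r by rewrite size_sort size_enum_ord.
have : perm_eq (Tuple st) (ord_tuple r) by rewrite /= perm_sort.
case/tuple_permP => s Es; exists s => a b lab.
have nthE (i : 'I_r) : nth i t i = s i.
  have -> : t = [seq tnth (ord_tuple r) (s i) | i <- enum 'I_r] := Es.
  by rewrite (nth_map i) ?size_enum_ord // nth_ord_enum tnth_ord_tuple.
have tleT : transitive leT by move=> x y z; rewrite /leT => h1 h2; apply: le_trans h2 h1.
have sst : sorted leT t by apply: sort_sorted => x y; rewrite /leT le_total.
rewrite -(nthE a) -(nthE b) (set_nth_default a b) ?(eqP st) //.
by apply: (sorted_leq_nth tleT (fun=> lexx _)) => //; rewrite inE (eqP st).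
Qed.

Lemma rearrangement (R : realType) (r : nat) (g a : 'I_r -> R) (s : 'S_r) :
  decreasing a -> decreasing (fun i => g (s i)) ->
  \sum_i g i * a i <= \sum_i g (s i) * a i.
Proof.
move=> ha hg; rewrite -subr_ge0 -sumrB.
rewrite (eq_bigr (fun i => a i * (g (s i) - g i))); last by move=> i _; ring.
apply: abel_sum_ge0 => // [k lkr|]; last first.
  by rewrite sumrB [X in _ - X](reindex_inj (@perm_inj _ s)) subrr.
rewrite sumrB subr_ge0.
(* A prefix of [g] is a sum of the sorted [g] over some [k] indices, hence at most the sorted
   prefix. *)
have EA : \sum_(i < r | (i < k)%N) g i = \sum_(j in [set j | (s j < k)%N]) g (s j).
  by rewrite (reindex_inj (@perm_inj _ s)); apply: eq_bigl => j; rewrite inE.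
have cA : #|[set j : 'I_r | (s j < k)%N]| = k.
  rewrite -[RHS](card_ord_prefix (ltnW lkr)) -[RHS](card_preimset _ (@perm_inj _ s)).
  by apply: eq_card => j; rewrite !inE.
by rewrite EA -[k in leRHS]cA; exact: (@sum_subset_le_prefix R r (fun i => g (s i))).
Qed.

(** * Subgradients of convex functions *)

Definition convex_rV (R : realType) (n : nat) (p : 'rV[R]_n -> R) : Prop :=
  forall (x y : 'rV[R]_n) (t : R), 0 <= t <= 1 ->
    p (t *: x + (1 - t) *: y) <= t * p x + (1 - t) * p y.

(* Hahn-Banach, one coordinate at a time: a slope [s] in the new direction [e] is squeezed between the difference quotients on both sides. *)
Lemma convex_support_step (R : realType) (n k : nat) (p : 'rV[R]_n -> R) (g : 'I_n -> R) :
  convex_rV p -> (k < n)%N ->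
  (forall x : 'rV[R]_n, (forall i : 'I_n, (k <= i)%N -> x 0 i = 0) -> \sum_i g i * x 0 i <= p x) ->
  exists g' : 'I_n -> R,
    forall x : 'rV[R]_n, (forall i : 'I_n, (k < i)%N -> x 0 i = 0) -> \sum_i g' i * x 0 i <= p x.
Proof.
move=> cp kn hg; pose j := Ordinal kn.
pose G (x : 'rV[R]_n) := \sum_i g i * x 0 i.
pose low (x : 'rV[R]_n) := forall i : 'I_n, (k <= i)%N -> x 0 i = 0.
pose e : 'rV[R]_n := delta_mx 0 j.
have GD a b x y : G (a *: x + b *: y) = a * G x + b * G y.
  rewrite /G !mulr_sumr -big_split /=; apply: eq_bigr => i _.
  by rewrite !mxE; ring.
pose lower := [set u : R | exists w t, [/\ low w, 0 < t & u = (G w - p (w - t *: e)) / t]]%classic.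
(* The weights [c = t / (t + t')] and [1 - c] cancel the displacements along [e], so the convex
   combination falls back into the subspace where [hg] applies. *)
have sep w t w' t' : low w -> low w' -> 0 < t -> 0 < t' ->
    (G w' - p (w' - t' *: e)) / t' <= (p (w + t *: e) - G w) / t.
  move=> lw lw' t0 t'0; have tt0 : 0 < t + t' by rewrite addr_gt0.
  pose c := t / (t + t').
  have c1E : 1 - c = t' / (t + t') by rewrite /c; field; rewrite gt_eqF.
  have c01 : 0 <= c <= 1.
    rewrite divr_ge0 ?(ltW t0) ?(ltW tt0) //= ler_pdivrMr // mul1r lerDl ltW //.
  have /= := cp (w' - t' *: e) (w + t *: e) c c01.
  have -> : c *: (w' - t' *: e) + (1 - c) *: (w + t *: e) = c *: w' + (1 - c) *: w.
    apply/rowP => i; rewrite !mxE c1E /c; field; rewrite gt_eqF //.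
  have lz : low (c *: w' + (1 - c) *: w).
    by move=> i ki; rewrite !mxE lw // lw' // !mulr0 addr0.
  move/(le_trans (hg _ lz)); rewrite -/(G _) GD c1E /c.
  set A := p _; set B := p _; set x := G w'; set y := G w => H.
  rewrite ler_pdivrMr // mulrAC ler_pdivlMr //.
  have := ler_wpM2r (ltW tt0) H.
  have -> : (t / (t + t') * x + t' / (t + t') * y) * (t + t') = t * x + t' * y.
    by field; rewrite gt_eqF.
  have -> : (t / (t + t') * A + t' / (t + t') * B) * (t + t') = t * A + t' * B.
    by field; rewrite gt_eqF.
  by move=> H2; lra.
have low0 : low 0 by move=> i _; rewrite mxE.
have ne : (lower !=set0)%classic by exists ((G 0 - p (0 - 1 *: e)) / 1), 0, 1.
have ub w t : low w -> 0 < t -> ubound lower ((p (w + t *: e) - G w) / t).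
  by move=> lw t0 _ [w' [t' [lw' t'0 ->]]]; apply: sep.
have hs : has_sup lower by split => //; exists ((p (0 + 1 *: e) - G 0) / 1); exact: ub.
pose s := sup lower.
exists (fun i => if i == j then s else g i) => x hx.
pose w := x - x 0 j *: e.
have lw : low w.
  move=> i; rewrite leq_eqVlt => /orP[/eqP ki|ki].
    have -> : i = j by apply/val_inj.
    by rewrite !mxE !eqxx mulr1 subrr.
  have ij : (i == j) = false by rewrite -val_eqE /= gtn_eqF.
  by rewrite !mxE ij andbF mulr0 subr0 hx.
have -> : \sum_i (if i == j then s else g i) * x 0 i = G w + s * x 0 j.
  rewrite (bigD1 j) //= eqxx /G [in RHS](bigD1 j) //= (lw j) // mulr0 add0r addrC; congr (_ + _).
  by apply: eq_bigr => i ij; rewrite (negPf ij) !mxE (negPf ij) andbF mulr0 subr0.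
have xE : x = w + x 0 j *: e by rewrite subrK.
have [xn|xp|x0] := ltrgtP (x 0 j) 0.
- have t0 : 0 < - x 0 j by rewrite oppr_gt0.
  have : (G w - p (w - (- x 0 j) *: e)) / (- x 0 j) <= s.
    by apply: ub_le_sup => //; [case: hs | exists w, (- x 0 j)].
  by rewrite scaleNr opprK -xE ler_pdivrMr // => H; lra.
- have : s <= (p (w + x 0 j *: e) - G w) / x 0 j by apply: ge_sup => //; exact: ub.
  by rewrite -xE ler_pdivlMr // => H; lra.
- by rewrite {2}xE x0 scale0r mulr0 !addr0; exact: hg.
Qed.

(** After moving [a] to the origin and subtracting [p a], the zero functional works on the zero
    subspace, and [convex_support_step] frees one coordinate at a time. *)
Lemma convex_support (R : realType) (n : nat) (p : 'rV[R]_n -> R) (a : 'rV[R]_n) :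
  convex_rV p ->
  exists g : 'I_n -> R, forall x : 'rV[R]_n, p a + \sum_i g i * (x 0 i - a 0 i) <= p x.
Proof.
move=> cp; pose q x := p (a + x) - p a.
have cq : convex_rV q.
  move=> x y t t01; rewrite /q.
  have -> : a + (t *: x + (1 - t) *: y) = t *: (a + x) + (1 - t) *: (a + y).
    by apply/rowP => i; rewrite !mxE; ring.
  by have := cp (a + x) (a + y) t t01; lra.
have q0 : q 0 = 0 by rewrite /q addr0 subrr.
have H k : (k <= n)%N -> exists g : 'I_n -> R,
    forall x : 'rV[R]_n, (forall i : 'I_n, (k <= i)%N -> x 0 i = 0) -> \sum_i g i * x 0 i <= q x.
  elim: k => [_|k IH kn].
    exists (fun=> 0) => x hx; have -> : x = 0 by apply/rowP => i; rewrite hx // mxE.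
    by rewrite q0 big1 // => i _; rewrite mul0r.
  by have [g hg] := IH (ltnW kn); exact: (convex_support_step cq kn hg).
have [g hg] := H n (leqnn n); exists g => x.
have := hg (x - a); rewrite /q (addrC a) subrK lerBrDl.
rewrite (eq_bigr (fun i => g i * (x 0 i - a 0 i))); last by move=> i _; rewrite !mxE.
by apply=> i; rewrite leqNgt ltn_ord.
Qed.

Definition row_of (R : realType) (r : nat) (x : 'I_r -> R) : 'rV[R]_r := \row_i x i.

(** A subgradient at [a] is tested at [x] permuted by the inverse of the sorting permutation, where
    [p] has the same value. The pairing with [x] becomes that of the sorted [g], while sorting only
    increases the subtracted pairing with the decreasing [a]. *)
Lemma schur_support (R : realType) (r : nat) (p : 'rV[R]_r -> R) (a : 'I_r -> R) :
  convex_rV p ->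
  (forall (s : 'S_r) x, p (row_of (fun i => x (s i))) = p (row_of x)) ->
  decreasing a ->
  exists2 g : 'I_r -> R, decreasing g &
    forall x, p (row_of a) + \sum_i g i * (x i - a i) <= p (row_of x).
Proof.
move=> cp sp ha; have [g hg] := convex_support (row_of a) cp.
have [s hs] := exists_sorting_perm g; exists (fun i => g (s i)) => // x.
apply: (@le_trans _ _ (p (row_of a) + \sum_i g i * (x (s^-1%g i) - a i))); last first.
  have := hg (row_of (fun i => x (s^-1%g i))); rewrite sp.
  by rewrite (eq_bigr (fun i => g i * (x (s^-1%g i) - a i))) // => i _; rewrite !mxE.
rewrite lerD2l (eq_bigr (fun i => g (s i) * x i - g (s i) * a i)); last by move=> i _; ring.
rewrite [leRHS](eq_bigr (fun i => g i * x (s^-1%g i) - g i * a i)); last by move=> i _; ring.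
rewrite !sumrB [X in _ <= X - _](reindex_inj (@perm_inj _ s)) /=.
under [X in _ <= X - _]eq_bigr do rewrite permK.
by rewrite lerB // rearrangement.
Qed.

(** * Symmetric gauge functions *)

Section Gauge.
Variables (R : realType) (N : nat) (I : 'I_N -> nat).
Local Notation n := (tdim I).
Variable rho : ('I_n -> R) -> R.
Hypothesis hrho : sym_gauge rho.

Let rhoZ (c : R) x : rho (fun k => c * x k) = `|c| * rho x := hrho.2.1 c x.
Let rhoD x y : rho (fun k => x k + y k) <= rho x + rho y := hrho.2.2.1 x y.

Lemma gauge_ge0 x : 0 <= rho x.
Proof.
have [[k xk]|nx] := pselect (exists k, x k != 0).
  by apply/ltW/hrho.1; exists k.
have -> : x = (fun k => 0 * x k).
  apply/funext => k; rewrite mul0r; apply/eqP; apply: contra_notT nx => xk.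
  by exists k.
by rewrite rhoZ normr0 mul0r.
Qed.

(* Shrinking one coordinate by [c] in [0, 1] averages the vector with its reflection in that coordinate. *)
Lemma gauge_shrink (k : 'I_n) (c : R) x :
  0 <= c <= 1 -> rho (fun i => if i == k then c * x i else x i) <= rho x.
Proof.
move=> /andP[c0 c1].
pose e (i : 'I_n) := i == k.
have -> : (fun i => if i == k then c * x i else x i) =
    (fun i => (fun i => (1 + c) / 2 * x i) i + (fun i => (1 - c) / 2 * ((-1) ^+ e i * x i)) i).
  by apply/funext => i; rewrite /e; case: eqP => _ /=; rewrite ?expr0 ?expr1; lra.
apply: le_trans (rhoD _ _) _.
have h1 : 0 <= (1 + c) / 2 by lra.
have h2 : 0 <= (1 - c) / 2 by lra.
by rewrite !rhoZ (hrho.2.2.2.2 e x) !ger0_norm //; lra.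
Qed.

(** The coordinates of [y] are shrunk to those of [x] one at a time; [z m] has the first [m] already
    replaced. *)
Lemma gauge_mono (x y : 'I_n -> R) : (forall i, 0 <= x i <= y i) -> rho x <= rho y.
Proof.
move=> hxy; pose z m (i : 'I_n) := if (i < m)%N then x i else y i.
have H m : (m <= n)%N -> rho (z m) <= rho y.
  elim: m => [_|m IH mn]; first by have -> : z 0%N = y by apply/funext.
  pose k := Ordinal mn.
  (* If [y k] is 0, the quotient is 0 by convention, which is right because [x k] is then 0 too. *)
  apply: le_trans (IH (ltnW mn)); pose c := x k / y k.
  have /andP[x0 xy] := hxy k.
  have y0 : 0 <= y k by exact: le_trans xy.
  have -> : z m.+1 = (fun i => if i == k then c * z m i else z m i).
    apply/funext => i; rewrite /z ltnS; case: eqP => [->|ik] /=.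
      rewrite leqnn ltnn /c; have [yk|yk] := eqVneq (y k) 0; last by rewrite divfK.
      by rewrite yk mulr0; apply/eqP; rewrite eq_le x0 -yk xy.
    rewrite leq_eqVlt (_ : (i == m :> nat) = false) //.
    by apply/eqP => im; apply: ik; apply/val_inj.
  apply: gauge_shrink; rewrite /c divr_ge0 //=.
  have [->|yk] := eqVneq (y k) 0; first by rewrite invr0 mulr0.
  by rewrite ler_pdivrMr ?mul1r // lt_neqAle eq_sym yk.
have := H n (leqnn n); have -> // : z n = x.
by apply/funext => i; rewrite /z ltn_ord.
Qed.

(** Padding both lists with explicit zeros up to length [n] agrees with the default of [nth 0] and
    turns a permutation of lists into one of ['I_n]. *)
Lemma gauge_perm_eq (s s' : seq R) : (size s <= n)%N -> perm_eq s s' ->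
  rho (fun k => nth 0 s k) = rho (fun k => nth 0 s' k).
Proof.
move=> sn ps; pose pad (u : seq R) := u ++ nseq (n - size u) 0.
have nth_pad (u : seq R) i : nth 0 (pad u) i = nth 0 u i.
  by rewrite nth_cat nth_nseq if_same; case: ltnP => // ui; rewrite nth_default.
have sp u : (size u <= n)%N -> size (pad u) == n.
  by move=> un; rewrite size_cat size_nseq subnKC.
have sn' : (size s' <= n)%N by rewrite -(perm_size ps).
have : perm_eq (Tuple (sp _ sn)) (Tuple (sp _ sn')).
  by rewrite /= /pad (perm_size ps) perm_cat2r.
case/tuple_permP => t Et.
rewrite -[RHS](hrho.2.2.2.1 t); congr rho; apply/funext => k.
rewrite -nth_pad; have -> : pad s = [seq tnth (Tuple (sp _ sn')) (t i) | i <- enum 'I_n] := Et.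
by rewrite (nth_map k) ?size_enum_ord // nth_ord_enum (tnth_nth 0) /= nth_pad.
Qed.

(** Zeros moved to the end of the list coincide with the default value. Hence [rho] does not see
    whether zero eigenvalues are listed. *)
Lemma gauge_filter_neq0 (s : seq R) : (size s <= n)%N ->
  rho (fun k => nth 0 [seq x <- s | x != 0] k) = rho (fun k => nth 0 s k).
Proof.
move=> sn; rewrite (gauge_perm_eq sn (s' := [seq x <- s | x != 0] ++ [seq x <- s | ~~ (x != 0)])); last first.
  by rewrite perm_sym perm_filterC.
congr rho; apply/funext => k; rewrite nth_cat; case: ltnP => // sk.
rewrite nth_default //; case: (ltnP (k - size [seq x <- s | x != 0]) (size [seq x <- s | ~~ (x != 0)])) => h; last by rewrite nth_default.
have := mem_nth 0 h; rewrite mem_filter negbK => /andP[/eqP -> //].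
Qed.

(** The padding from [r] to [n] takes place after [f] is applied, so [f 0] does not enter there;
    this matches [hfun], which applies [f] to the listed eigenvalues only. *)
Definition gauge_fun (r : nat) (f : R -> R) (x : 'rV[R]_r) : R :=
  rho (fun k => nth 0 [seq f (x 0 i) | i <- enum 'I_r] k).

(** Convexity of [f] compares nonnegative entries, so monotonicity of [rho] applies, followed by the
    triangle inequality. *)
Lemma gauge_fun_convex r f : (r <= n)%N -> convex_fun f -> (forall x, 0 <= f x) ->
  convex_rV (@gauge_fun r f).
Proof.
move=> rn cf f0 x y t t01; have /andP[t0 t1] := t01.
have nthE (u : 'rV[R]_r) (k : nat) : nth 0 [seq f (u 0 i) | i <- enum 'I_r] k =
    if insub k is Some i then f (u 0 i) else 0.
  case: insubP => [i ik <-|]; last by rewrite -leqNgt => rk; rewrite nth_default // size_map size_enum_ord.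
  by rewrite (nth_map i) ?size_enum_ord //= nth_ord_enum.
rewrite /gauge_fun; set X := (fun k : 'I_n => nth 0 [seq f (x 0 i) | i <- _] k).
set Y := (fun k : 'I_n => nth 0 [seq f (y 0 i) | i <- _] k).
apply: (@le_trans _ _ (rho (fun k => (fun k => t * X k) k + (fun k => (1 - t) * Y k) k))).
  apply: gauge_mono => k; rewrite /X /Y !nthE.
  by case: insub => [i|]; rewrite ?mulr0 ?addr0 ?lexx // f0 !mxE /=; exact: cf.
by apply: le_trans (rhoD _ _) _; rewrite !rhoZ !ger0_norm ?subr_ge0.
Qed.

Lemma gauge_fun_perm r f (s : 'S_r) x : (r <= n)%N ->
  gauge_fun f (row_of (fun i => x (s i))) = gauge_fun f (row_of x).
Proof.
move=> rn; apply: gauge_perm_eq; first by rewrite size_map size_enum_ord.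
have -> : [seq f (row_of (fun i => x (s i)) 0 i) | i <- enum 'I_r] =
    [seq f (x j) | j <- [seq s i | i <- enum 'I_r]].
  by rewrite -map_comp; apply: eq_map => i; rewrite /= !mxE.
rewrite (eq_map (g := fun j => f (x j))); last by move=> i; rewrite !mxE.
apply: perm_map; apply: uniq_perm; rewrite ?(map_inj_uniq (@perm_inj _ s)) ?enum_uniq //.
by move=> j; rewrite mem_enum; apply/mapP; exists (s^-1%g j); rewrite ?mem_enum ?permKV.
Qed.

End Gauge.

(** * Orthonormal families, quadratic forms and eigenvalue counts *)

Lemma ofRE (R : realType) (x : R) : ofR x = (x%:C)%C.
Proof. by []. Qed.

(** More unknowns than equations: the block of [M] on [A] and [B] has a nonzero left kernel vector,
    which is extended by zero outside [A]. *)
Lemma exists_supported_kernel (F : fieldType) (S T : finType) (A : {set S}) (B : {set T})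
    (M : S -> T -> F) : (#|B| < #|A|)%N ->
  exists v : S -> F, [/\ exists a, v a != 0, forall a, a \notin A -> v a = 0
    & forall b, b \in B -> \sum_a v a * M a b = 0].
Proof.
move=> ltBA; pose m : 'M[F]_(#|A|, #|B|) := \matrix_(i, j) M (enum_val i) (enum_val j).
pose w := nz_row (kermx m).
have w0 : w != 0.
  by rewrite nz_row_eq0 -mxrank_eq0 mxrank_ker -lt0n subn_gt0 (leq_ltn_trans (rank_leq_col m)).
have wm : w *m m = 0 by apply/sub_kermxP; exact: nz_row_sub.
(* The sum has one term for [a] in [A] and none otherwise. *)
pose v a := \sum_(i | enum_val i == a) w 0 i.
have vE (i : 'I_#|A|) : v (enum_val i) = w 0 i.
  by rewrite /v (big_pred1 i) // => k; rewrite (inj_eq enum_val_inj).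
exists v; split.
- have [i wi] : exists i, w 0 i != 0.
    apply/existsP; apply: contraNT w0; rewrite negb_exists => /forallP h.
    by apply/eqP/rowP => i; rewrite mxE; apply/eqP; rewrite -[_ == _]negbK.
  by exists (enum_val i); rewrite vE.
- by move=> a aA; rewrite /v big1 // => i /eqP ia; rewrite -ia enum_valP in aA.
- move=> b bB; have := congr1 (fun u : 'rV_#|B| => u 0 (enum_rank_in bB b)) wm.
  rewrite !mxE => Eb; rewrite -[RHS]Eb.
  under [RHS]eq_bigr do rewrite mxE enum_rankK_in //.
  rewrite [RHS](partition_big (fun i => enum_val i) predT) //=.
  by apply: eq_bigr => a _; rewrite mulr_suml; apply: eq_bigr => i /eqP ->.
Qed.

Section Spectral.
Variables (R : realType) (N : nat) (I : 'I_N -> nat).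
Local Notation T := (tensor R I).
Local Notation V := (vtensor R I).
Implicit Types (H : T) (x y : V).

Definition ip x y : R[i] := \sum_i (x i)^* * y i.
Definition qform H x : R[i] := \sum_i \sum_j (x i)^* * H i j * x j.
Definition comb r (w : 'I_r -> R[i]) (U : 'I_r -> V) : V := fun i => \sum_a w a * U a i.

Lemma ip_conj x y : (ip x y)^* = ip y x.
Proof.
rewrite /ip rmorph_sum; apply: eq_bigr => i _.
by rewrite rmorphM /= conjCK mulrC.
Qed.

Lemma ipE x : ip x x = \sum_i `|x i| ^+ 2.
Proof. by apply: eq_bigr => i _; rewrite normCK mulrC. Qed.

Lemma ip_ge0 x : 0 <= ip x x.
Proof. by rewrite ipE sumr_ge0 // => i _; rewrite exprn_ge0. Qed.

Lemma ip_comb r (w : 'I_r -> R[i]) U x : ip x (comb w U) = \sum_a w a * ip x (U a).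
Proof.
under eq_bigr do rewrite mulr_sumr.
rewrite exchange_big /=; apply: eq_bigr => a _.
by rewrite mulr_sumr; apply: eq_bigr => i _; ring.
Qed.

Lemma ip_sub x y z : ip x (fun i => y i - z i) = ip x y - ip x z.
Proof. by rewrite -sumrB; apply: eq_bigr => i _; ring. Qed.

Lemma orthonormal_coord r (w : 'I_r -> R[i]) U b :
  Defs.orthonormal U -> ip (U b) (comb w U) = w b.
Proof.
move=> oU; rewrite ip_comb (bigD1 b) //= {1}/ip oU eqxx mulr1 big1 ?addr0 // => a ab.
by rewrite {1}/ip oU eq_sym (negPf ab) mulr0.
Qed.

Lemma orthonormal_norm r (w : 'I_r -> R[i]) U :
  Defs.orthonormal U -> ip (comb w U) (comb w U) = \sum_a `|w a| ^+ 2.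
Proof.
move=> oU; rewrite ip_comb; apply: eq_bigr => a _.
by rewrite -ip_conj orthonormal_coord // normCK.
Qed.

(** The residue [y] of the projection of [x] is orthogonal to every [U a], so the nonnegative
    [ip y y] is, up to conjugation, the difference of the two sides. *)
Lemma bessel r (U : 'I_r -> V) x :
  Defs.orthonormal U -> \sum_a `|ip (U a) x| ^+ 2 <= ip x x.
Proof.
move=> oU; pose c a := ip (U a) x; pose y : V := fun i => x i - comb c U i.
have yU a : ip y (U a) = 0.
  by rewrite -ip_conj ip_sub orthonormal_coord // subrr rmorph0.
have yy : ip y y = (ip x x - \sum_a `|c a| ^+ 2)^*.
  rewrite {1}/y ip_sub ip_comb [X in _ - X]big1 ?subr0; last by move=> a _; rewrite yU mulr0.
  rewrite -ip_conj ip_sub ip_comb; congr (_ - _)^*.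
  by apply: eq_bigr => a _; rewrite -(ip_conj (U a)) normCK.
rewrite -subr_ge0; set z := (X in 0 <= X).
have : 0 <= z^* by rewrite -yy ip_ge0.
by move=> z0; rewrite -[z]conjCK conj_Creal // ger0_real.
Qed.

Lemma qform_herm_sum r (l : 'I_r -> R) U x :
  qform (herm_sum l U) x = \sum_a ofR (l a) * `|ip (U a) x| ^+ 2.
Proof.
transitivity (\sum_i \sum_j \sum_a ofR (l a) * (((x i)^* * U a i) * ((U a j)^* * x j))).
  apply: eq_bigr => i _; apply: eq_bigr => j _.
  by rewrite /herm_sum mulr_sumr mulr_suml; apply: eq_bigr => a _; rewrite /outerH; ring.
under eq_bigr do rewrite exchange_big.
rewrite exchange_big /=; apply: eq_bigr => a _.
rewrite normCK ip_conj /ip mulr_suml mulr_sumr exchange_big /=.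
apply: eq_bigr => i _; rewrite mulr_sumr mulr_sumr; apply: eq_bigr => j _; ring.
Qed.

(* If fewer eigenvalues of [H'] than of [H] were large, some nonzero [x] in the span of the large eigenvectors of [H] would be orthogonal to those of [H']. *)
Lemma eig_count_le r r' (l : 'I_r -> R) (l' : 'I_r' -> R) U U' H H' (c e : R) :
  0 <= c -> herm_decomp H l U -> herm_decomp H' l' U' ->
  (forall x, qform H x <= qform H' x + ofR e * ip x x) ->
  (#|[set a | (c + e < l a)%R]| <= #|[set b | (c < l' b)%R]|)%N.
Proof.
move=> c0 [oU EH] [oU' EH'] hq; rewrite leqNgt; apply/negP => lt.
have [v [[a0 va0] vA vB]] := exists_supported_kernel (fun a b => ip (U' b) (U a)) lt.
pose x := comb v U.
have xU' b : (c < l' b)%R -> ip (U' b) x = 0 by move=> h; rewrite ip_comb vB // inE.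
have xx : ip x x = \sum_a `|v a| ^+ 2 by exact: orthonormal_norm.
(* The [U' b] need not span, so the coordinates of [x] only satisfy Bessel's inequality; multiplying
   it by [c] uses [0 <= c]. *)
have q' : qform H' x <= ofR c * ip x x.
  apply: le_trans (ler_wpM2l _ (bessel x oU')); last by rewrite ofRE ler0c.
  rewrite EH' qform_herm_sum mulr_sumr; apply: ler_sum => b _.
  have [h|h] := ltP c (l' b); first by rewrite xU' // normr0 expr0n /= !mulr0.
  by rewrite ler_wpM2r ?exprn_ge0 // !ofRE lecR.
have : qform H x <= ofR (c + e) * ip x x.
  apply: le_trans (hq x) _.
  by rewrite (_ : ofR (c + e) = ofR c + ofR e) ?mulrDl ?lerD2r // !ofRE rmorphD.
(* The order on [R[i]] is partial: negating the inequality requires both sides to be real. *)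
apply/negP; rewrite -real_ltNge; last 2 first.
- by rewrite rpredM ?(ger0_real (ip_ge0 x)) //; apply/complex_realP; exists (c + e).
- rewrite EH qform_herm_sum; apply: rpred_sum => a _.
  by rewrite rpredM ?(ger0_real (exprn_ge0 _ _)) //; apply/complex_realP; exists (l a).
rewrite -subr_gt0 EH qform_herm_sum xx mulr_sumr -sumrB.
have term a : 0 <= ofR (l a) * `|ip (U a) x| ^+ 2 - ofR (c + e) * `|v a| ^+ 2.
  rewrite orthonormal_coord // -mulrBl.
  have [aA|aA] := boolP (a \in [set a | (c + e < l a)%R]); last first.
    by rewrite vA // normr0 expr0n /= mulr0.
  rewrite mulr_ge0 ?exprn_ge0 // subr_ge0 !ofRE lecR ltW //.
  by rewrite inE in aA.
rewrite (bigD1 a0) //=; apply: ltr_pwDl; last by apply: sumr_ge0 => a _; exact: term.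
rewrite orthonormal_coord // -mulrBl mulr_gt0 ?exprn_gt0 ?normr_gt0 // subr_gt0 !ofRE ltcR.
have : a0 \in [set a | (c + e < l a)%R] by apply: contraNT va0 => /vA ->.
by rewrite inE.
Qed.

Lemma orthonormal_size r (U : 'I_r -> V) : Defs.orthonormal U -> (r <= tdim I)%N.
Proof.
move=> oU; rewrite leqNgt; apply/negP => lt.
have lt' : (#|[set: mindex I]| < #|[set: 'I_r]|)%N by rewrite !cardsT card_ord.
have [v [[a va] _ vB]] := exists_supported_kernel (fun a i => U a i) lt'.
move/eqP: va; apply; rewrite -(orthonormal_coord v a oU) /ip big1 // => i _.
by rewrite /comb vB ?mulr0 // inE.
Qed.

End Spectral.

(** * Uniqueness of the nonzero eigenvalues and the chosen decomposition *)

(** The multiplicity of [v > 0] is the number of entries above a level just below [v] minus the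
    number above [v]. Negative values are handled through their opposites. *)
Lemma perm_eq_count_gt (R : realType) (s s' : seq R) :
  (forall c, 0 <= c -> count (fun x => c < x) s = count (fun x => c < x) s') ->
  (forall c, 0 <= c -> count (fun x => c < - x) s = count (fun x => c < - x) s') ->
  perm_eq [seq x <- s | x != 0] [seq x <- s' | x != 0].
Proof.
have key (u u' : seq R) v : 0 < v ->
    (forall c, 0 <= c -> count (fun x => c < x) u = count (fun x => c < x) u') ->
    count_mem v u = count_mem v u'.
  (* No entry of either list lies strictly between [c] and [v]; starting the maximum at 0 keeps the
     level nonnegative. *)
  move=> v0 h; pose c := \big[Num.max/0]_(x <- u ++ u' | x < v) x.
  have cv : c < v by rewrite /c; elim/big_rec: _ => // x y xv yv; rewrite gt_max xv.
  have c0 : 0 <= c.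
    by rewrite /c; elim/big_rec: _ => // x y xv y0; rewrite le_max y0 orbT.
  have gtE (w : seq R) : {subset w <= u ++ u'} ->
      count (fun x => c < x) w = (count_mem v w + count (fun x => v < x)%R w)%N.
    move=> sw; have I0 : count (predI (pred1 v) (fun x : R => v < x)) w = 0%N.
      by rewrite -(count_pred0 w); apply: eq_count => x /=; case: eqP => //= ->; rewrite ltxx.
    rewrite -count_predUI I0 addn0; apply: eq_in_count => x /sw xu /=.
    have [xv|vx|->] := ltgtP x v => //=; last exact: lt_trans vx.
    by rewrite ltNge /c (le_bigmax_seq 0 x (fun x => x < v) (fun x => x)).
  have := h c c0; rewrite (gtE u) ?(gtE u'); last 2 first.
  - by move=> x xu; rewrite mem_cat xu orbT.
  - by move=> x xu; rewrite mem_cat xu.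
  by rewrite (h v (ltW v0)) => /addIn.
move=> hp hn; apply/allP => /= v _; apply/eqP.
rewrite !count_filter.
have [vn|vp|->] := ltrgtP v 0; last first.
- have E (w : seq R) : count (predI (pred1 0) (fun x => x != 0)) w = 0%N.
    by rewrite -(count_pred0 w); apply: eq_count => x /=; case: eqP.
  by rewrite !E.
- have E (w : seq R) : count (predI (pred1 v) (fun x => x != 0)) w = count_mem v w.
    by apply: eq_count => x /=; case: eqP => // ->; rewrite gt_eqF.
  by rewrite !E; exact: key.
- have E (w : seq R) : count (predI (pred1 v) (fun x => x != 0)) w = count_mem (- v) (map -%R w).
    rewrite count_map; apply: eq_count => x /=; rewrite eqr_opp.
    by case: eqP => // ->; rewrite lt_eqF.
  rewrite !E; apply: key; first by rewrite oppr_gt0.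
  by move=> c c0; rewrite !count_map; exact: hn.
Qed.

Lemma card_count_map (T : finType) (U : Type) (P : pred U) (f : T -> U) :
  #|[set a | P (f a)]| = count P [seq f a | a <- enum T].
Proof.
rewrite cardE {1}/enum_mem size_filter count_map -enumT.
by apply: eq_count => a; rewrite /= inE.
Qed.

Section HermEig.
Variables (R : realType) (N : nat) (I : 'I_N -> nat).
Local Notation T := (tensor R I).
Local Notation V := (vtensor R I).
Implicit Types H : T.

Lemma herm_sumN r (l : 'I_r -> R) (U : 'I_r -> V) :
  herm_sum (fun a => - l a) U = (fun i j => - herm_sum l U i j).
Proof.
apply/funext => i; apply/funext => j; rewrite /herm_sum -sumrN.
by apply: eq_bigr => a _; rewrite -mulNr !ofRE rmorphN.
Qed.

Lemma herm_decompN H r (l : 'I_r -> R) (U : 'I_r -> V) :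
  herm_decomp H l U -> herm_decomp (fun i j => - H i j) (fun a => - l a) U.
Proof. by move=> [oU ->]; split; rewrite ?herm_sumN. Qed.

(** [eig_count_le] with [e = 0], used in both directions, equates the counts above each level
    [c >= 0]; the same for the opposite tensor covers the negative eigenvalues. *)
Lemma herm_decomp_unique H r r' (l : 'I_r -> R) (l' : 'I_r' -> R) U U' :
  herm_decomp H l U -> herm_decomp H l' U' ->
  perm_eq [seq x <- [seq l a | a <- enum 'I_r] | x != 0]
          [seq x <- [seq l' a | a <- enum 'I_r'] | x != 0].
Proof.
have key H0 s s' (m : 'I_s -> R) (m' : 'I_s' -> R) W W' c : 0 <= c ->
    herm_decomp H0 m W -> herm_decomp H0 m' W' ->
    (#|[set a | (c < m a)%R]| <= #|[set b | (c < m' b)%R]|)%N.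
  move=> c0 d d'; have := eig_count_le (e := 0) c0 d d'; rewrite addr0; apply => x.
  by rewrite !ofRE mul0r addr0.
move=> d d'; apply: perm_eq_count_gt => c c0; rewrite -!card_count_map; apply/eqP.
  by rewrite eqn_leq !(key H _ _ _ _ _ _ c c0 d d', key H _ _ _ _ _ _ c c0 d' d).
have [n n'] := (herm_decompN d, herm_decompN d').
by rewrite eqn_leq (key _ _ _ _ _ _ _ c c0 n n') (key _ _ _ _ _ _ _ c c0 n' n).
Qed.

Lemma herm_sum_hermitian r (l : 'I_r -> R) (U : 'I_r -> V) :
  Defs.hermitian (herm_sum l U).
Proof.
apply/funext => j; apply/funext => i; rewrite /ctrans rmorph_sum.
apply: eq_bigr => a _; rewrite /outerH !rmorphM /= conjCK mulrCA mulrC -!mulrA.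
have -> : (ofR (l a))^* = ofR (l a) by apply/CrealP/complex_realP; exists (l a).
by ring.
Qed.

Lemma herm_rank_exists H r (l : 'I_r -> R) (U : 'I_r -> V) :
  herm_decomp H l U -> exists r', herm_rank H r'.
Proof.
move=> d; pose P k := `[< exists (l : 'I_k -> R) (U : 'I_k -> V), herm_decomp H l U >].
have Pr : exists k, P k by exists r; apply/asboolP; exists l, U.
have [m /asboolP [l0 [U0 d0]] hm] := ex_minnP Pr.
exists m; split; first by rewrite d.2; exact: herm_sum_hermitian.
split; first by exists l0, U0.
by move=> r' l' U' d'; apply: hm; apply/asboolP; exists l', U'.
Qed.

(** A zero term could be dropped, contradicting minimality of [r]. *)
Lemma herm_rank_neq0 H r (l : 'I_r -> R) (U : 'I_r -> V) a :
  herm_rank H r -> herm_decomp H l U -> l a != 0.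
Proof.
move=> [_ [_ hmin]] [oU EH]; apply/eqP => la.
case: r l U a hmin oU EH la => [|r] l U a hmin oU EH la; first by case: a {la}.
suff : (r.+1 <= r)%N by rewrite ltnn.
apply: (hmin _ (fun b => l (lift a b)) (fun b => U (lift a b))); split.
  by move=> b c; rewrite oU (inj_eq (@lift_inj _ a)).
rewrite EH; apply/funext => i; apply/funext => j.
by rewrite /herm_sum (bigD1_ord a) //= la ofRE mul0r add0r.
Qed.

Lemma herm_rank_le H r : herm_rank H r -> (r <= tdim I)%N.
Proof. by move=> [_ [[l [U [oU _]]] _]]; exact: orthonormal_size oU. Qed.

(** Sorting a minimal decomposition shows that [epsilon] has a valid choice, and minimality on both
    sides identifies its length with [r]. *)
Lemma hspecP H r : herm_rank H r ->
  exists (l : 'I_r -> R) (U : 'I_r -> V),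
    [/\ hspec H = existT _ r (l, U), decreasing l & herm_decomp H l U].
Proof.
move=> hr; have [_ [[l [U [oU EH]]] hmin]] := hr.
have [s ds] := exists_sorting_perm l.
have : exists t, good_spec H t.
  exists (existT _ r ((fun a => l (s a)), (fun a => U (s a)))); split=> //; split=> //; split.
    by move=> a b; rewrite oU (inj_eq (@perm_inj _ s)).
  rewrite EH; apply/funext => i; apply/funext => j.
  by rewrite /herm_sum (reindex_inj (@perm_inj _ s)).
move/(ClassicalEpsilon.epsilon_spec (inhabits (existT _ 0%N ((fun _ => 0), (fun _ _ => 0)) : spec_data R I))).
rewrite -/(hspec H); case: (hspec H) => r' [l' U'] [hr' [dl' dU']].
have rr : r' = r.
  by apply/eqP; rewrite eqn_leq (hr'.2.2 _ _ _ (conj oU EH)) (hmin _ _ _ dU').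
by case: r / rr hr hmin l U oU EH s ds => *; exists l', U'.
Qed.

(** This allows [heig] to be computed from any convenient decomposition: the chosen one is minimal,
    so it contains no zero to filter out. *)
Lemma heig_perm H r (l : 'I_r -> R) (U : 'I_r -> V) :
  herm_decomp H l U ->
  perm_eq (heig H) [seq x <- [seq l a | a <- enum 'I_r] | x != 0].
Proof.
move=> d; have [r' hr'] := herm_rank_exists d.
have [l' [U' [E dl' d']]] := hspecP hr'.
rewrite /heig E; apply: perm_trans (herm_decomp_unique d' d).
rewrite (_ : [seq x <- _ | _] = [seq l' a | a <- enum 'I_r']) //.
apply/all_filterP/allP => _ /mapP[a _ ->]; exact: herm_rank_neq0 hr' d'.
Qed.

Lemma einstein_herm_sum r (l : 'I_r -> R) (U : 'I_r -> V) : Defs.orthonormal U ->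
  einstein (ctrans (herm_sum l U)) (herm_sum l U) = herm_sum (fun a => l a ^+ 2) U.
Proof.
move=> oU; rewrite [ctrans _](herm_sum_hermitian l U).
apply/funext => i; apply/funext => k; rewrite /einstein /herm_sum.
transitivity (\sum_a \sum_b ofR (l a) * ofR (l b) * U a i * (U b k)^* * ip (U a) (U b)).
  under eq_bigr do rewrite mulr_suml.
  rewrite exchange_big /=; apply: eq_bigr => a _.
  under eq_bigr do rewrite mulr_sumr.
  rewrite exchange_big /=; apply: eq_bigr => b _.
  by rewrite /ip mulr_sumr; apply: eq_bigr => j _; rewrite /outerH; ring.
apply: eq_bigr => a _; rewrite (bigD1 a) //= {1}/ip oU eqxx mulr1 big1 ?addr0.
  by rewrite /outerH !ofRE expr2 rmorphM mulrA.
by move=> b ab; rewrite /ip oU eq_sym (negPf ab) mulr0.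
Qed.

(** The product of [hfun f H] with its conjugate transpose has eigenvalues [f (l a) ^+ 2] on the
    same vectors, and [f >= 0] makes their square roots [f (l a)]. The zeros lost to minimal
    decompositions do not change [rho]. *)
Lemma ui_norm_hfun rho H r (f : R -> R) :
  @sym_gauge R N I rho -> herm_rank H r -> (forall u, 0 <= f u) ->
  ui_norm rho (hfun f H) = rho (fun k => nth 0 [seq f x | x <- heig H] k).
Proof.
move=> hrho hr f0; have [l [U [E dl [oU EH]]]] := hspecP hr.
set A := hfun f H; have EA : A = herm_sum (fun a => f (l a)) U by rewrite /A /hfun E.
have dAA : herm_decomp (einstein (ctrans A) A) (fun a => f (l a) ^+ 2) U.
  by rewrite EA einstein_herm_sum.
have [r' hr'] := herm_rank_exists dAA.
have [m [W [Em dm dW]]] := hspecP hr'.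
have dT : herm_decomp (tabs A) (fun a => Num.sqrt (m a)) W.
  by split; [exact: dW.1 | rewrite /tabs /hfun Em].
have hm : perm_eq [seq m a | a <- enum 'I_r'] [seq x <- [seq f (l a) ^+ 2 | a <- enum 'I_r] | x != 0].
  by have := heig_perm dAA; rewrite /heig Em.
have hp : perm_eq (heig (tabs A)) [seq x <- [seq f x | x <- heig H] | x != 0].
  apply: perm_trans (heig_perm dT) _.
  rewrite (map_comp Num.sqrt m) /heig E.
  have := perm_filter (fun x => x != 0) (perm_map Num.sqrt hm); move/perm_trans; apply.
  rewrite !filter_map -!map_comp.
  rewrite -filter_predI.
  under eq_filter => a /=.
    rewrite sqrtr_eq0 sqrf_eq0 real_leNgt ?num_real // exprn_even_gt0 //= negbK andbb.
    over.
  under eq_map => a /= do rewrite sqrtr_sqr ger0_norm //.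
  by [].
have rn := herm_rank_le hr.
have sH : size [seq f x | x <- heig H] = r by rewrite size_map /heig E size_map size_enum_ord.
rewrite /ui_norm /singvals -[RHS](gauge_filter_neq0 hrho) ?sH //.
apply: (gauge_perm_eq hrho _ hp); rewrite (perm_size hp) size_filter.
by apply: leq_trans (count_size _ _) _; rewrite sH.
Qed.

Lemma heig_map_nth H r : herm_rank H r ->
  heig H = [seq nth 0 (heig H) (i : 'I_r) | i <- enum 'I_r].
Proof.
move=> hr; have [l [U [E _ _]]] := hspecP hr; rewrite /heig E; apply: eq_map => i.
by rewrite (nth_map i) ?size_enum_ord // nth_ord_enum.
Qed.

Lemma heigP H r : herm_rank H r ->
  exists U : 'I_r -> V, [/\ size (heig H) = r, decreasing (fun a : 'I_r => nth 0 (heig H) a)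
    & herm_decomp H (fun a : 'I_r => nth 0 (heig H) a) U].
Proof.
move=> hr; have [l [U [E dl dH]]] := hspecP hr; exists U.
have -> : (fun a : 'I_r => nth 0 (heig H) a) = l.
  by apply/funext => a; rewrite /heig E (nth_map a) ?size_enum_ord // nth_ord_enum.
by split=> //; rewrite /heig E size_map size_enum_ord.
Qed.

End HermEig.

(** * Boundedness and measurability of the eigenvalues *)

(** The indices with value above [c] form a prefix; this translates counts of eigenvalues into
    bounds on the [i]-th one. *)
Lemma decreasing_gt_card (R : realType) (r : nat) (l : 'I_r -> R) (c : R) (i : 'I_r) :
  decreasing l -> (c < l i) = (i < #|[set a | (c < l a)%R]|)%N.
Proof.
move=> dl; apply/idP/idP => [h|].
  rewrite -[X in (X < _)%N]/(i : nat) -(card_ord_prefix (ltn_ord i)).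
  by apply/subset_leq_card/fintype.subsetP => a; rewrite !inE ltnS => /dl; exact: lt_le_trans.
apply: contraTT; rewrite -leNgt -leqNgt => h.
rewrite -[X in (_ <= X)%N](card_ord_prefix (ltnW (ltn_ord i))).
apply/subset_leq_card/fintype.subsetP => a; rewrite !inE ltnNge; apply: contraTN => /dl ia.
by rewrite -leNgt; exact: le_trans h.
Qed.

Section Analytic.
Variables (R : realType) (N : nat) (I : 'I_N -> nat).
Local Notation T := (tensor R I).
Local Notation V := (vtensor R I).
Implicit Types H : T.

Let sqn (x : V) := \sum_i cabs2 (x i).

Let ofR_sqn x : ((sqn x)%:C)%C = ip x x.
Proof. by rewrite ipE /sqn rmorph_sum; apply: eq_bigr => i _; exact: add_Re2_Im2. Qed.

Let mul_comb r (l : 'I_r -> R) (U : 'I_r -> V) (x : V) :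
  (fun i => \sum_j herm_sum l U i j * x j) = comb (fun a => ofR (l a) * ip (U a) x) U.
Proof.
apply/funext => i; rewrite /comb /herm_sum.
under eq_bigr do rewrite mulr_suml.
rewrite exchange_big /=; apply: eq_bigr => a _.
by rewrite /ip mulr_sumr mulr_suml; apply: eq_bigr => j _; rewrite /outerH; ring.
Qed.

Let sqn_mul r (l : 'I_r -> R) (U : 'I_r -> V) (x : V) : Defs.orthonormal U ->
  ((sqn (fun i => \sum_j herm_sum l U i j * x j))%:C)%C = \sum_a ((l a ^+ 2)%:C)%C * `|ip (U a) x| ^+ 2.
Proof.
move=> oU; rewrite mul_comb ofR_sqn orthonormal_norm //; apply: eq_bigr => a _.
rewrite normrM exprMn ofRE; congr (_ * _).
by rewrite rmorphXn real_normK //; apply/complex_realP; exists (l a).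
Qed.

Lemma eig_le_opnorm H r (l : 'I_r -> R) (U : 'I_r -> V) a :
  herm_decomp H l U -> `|l a| <= opnorm H.
Proof.
move=> [oU ->]; apply: ub_le_sup; last first.
  have sqU : sqn (U a) = 1 by apply: (@complexI R); rewrite ofR_sqn {1}/ip oU eqxx.
  exists (U a); first by rewrite /= /vnorm -/(sqn _) sqU sqrtr1.
  rewrite /vnorm -/(sqn _) (_ : sqn _ = l a ^+ 2) ?sqrtr_sqr //.
  apply: (@complexI R); rewrite sqn_mul // (bigD1 a) //= {1}/ip oU eqxx normr1 expr1n mulr1.
  by rewrite big1 ?addr0 // => b ab; rewrite /ip oU (negPf ab) normr0 expr0n /= mulr0.
(* A [sup] dominates its elements only if the set is bounded above; the Hilbert-Schmidt norm is a
   bound by Bessel's inequality. *)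
exists (Num.sqrt (\sum_b l b ^+ 2)) => _ [x /= x1 <-].
rewrite /vnorm -/(sqn _); apply: ler_wsqrtr.
have sx : sqn x <= 1.
  by rewrite -ler_sqrt // sqrtr1; move: x1; rewrite /vnorm.
have s0 : 0 <= \sum_b l b ^+ 2 by apply: sumr_ge0 => b _; exact: sqr_ge0.
rewrite -lecR sqn_mul //; apply: (@le_trans _ _ (((\sum_b l b ^+ 2)%:C)%C * ip x x)).
  apply: le_trans (ler_wpM2l _ (bessel x oU)); last by rewrite ler0c.
  rewrite mulr_sumr; apply: ler_sum => b _; rewrite ler_wpM2r ?exprn_ge0 // lecR.
  by rewrite (bigD1 b) //= lerDl sumr_ge0 // => c _; exact: sqr_ge0.
by rewrite -ofR_sqn -rmorphM lecR ler_piMr.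
Qed.

(** Each [|x i| |x j|] is at most the mean of the two squares, and summing over all pairs produces
    the factor [#|mindex I|]. *)
Lemma qform_perturb H H' (d : R) x :
  qform H x \is Num.real -> qform H' x \is Num.real -> 0 <= d ->
  (forall i j, `|H i j - H' i j| <= ofR d) ->
  qform H x <= qform H' x + ofR (d * #|mindex I|%:R) * ip x x.
Proof.
move=> rH rH' d0 hd; rewrite -lerBlDl.
apply: (le_trans (real_ler_norm (rpredB rH rH'))).
rewrite /qform -sumrB; under eq_bigr do rewrite -sumrB.
apply: (@le_trans _ _ (\sum_i \sum_j ofR d * ((`|x i| ^+ 2 + `|x j| ^+ 2) / 2))).
  apply: le_trans (ler_norm_sum _ _ _) _; apply: ler_sum => i _.
  apply: le_trans (ler_norm_sum _ _ _) _; apply: ler_sum => j _.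
  rewrite -mulrBl -mulrBr !normrM norm_conjC.
  rewrite [X in X * _]mulrC -mulrA; apply: ler_pM => //.
  rewrite ler_pdivlMr // -subr_ge0.
  have -> : `|x i| ^+ 2 + `|x j| ^+ 2 - `|x i| * `|x j| * 2 = (`|x i| - `|x j|) ^+ 2 by ring.
  by rewrite real_exprn_even_ge0 // rpredB // normr_real.
under eq_bigr do rewrite -mulr_sumr.
rewrite -mulr_sumr.
have -> : \sum_i \sum_j ((`|x i| ^+ 2 + `|x j| ^+ 2) / 2) = #|mindex I|%:R * ip x x.
  transitivity (\sum_i \sum_(j : mindex I) `|x i| ^+ 2 / 2 + \sum_(i : mindex I) \sum_j `|x j| ^+ 2 / 2).
    rewrite -big_split; apply: eq_bigr => i _.
    by rewrite -big_split; apply: eq_bigr => j _; rewrite mulrDl.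
  rewrite [X in _ + X]exchange_big /= -big_split /= ipE mulr_sumr; apply: eq_bigr => i _.
  by rewrite sumr_const -mulr_natr; field.
by rewrite !ofRE rmorphM rmorph_nat mulrA.
Qed.

Lemma qform_real H r (l : 'I_r -> R) (U : 'I_r -> V) x :
  herm_decomp H l U -> qform H x \is Num.real.
Proof.
move=> [oU ->]; rewrite qform_herm_sum; apply: rpred_sum => a _.
by rewrite rpredM ?(ger0_real (exprn_ge0 _ _)) //; apply/complex_realP; exists (l a).
Qed.

(* Only levels [c >= 0]: the number of eigenvalues above [c] is then insensitive to whether zero eigenvalues are listed. *)
Lemma open_eig_gt (X : topologicalType) (D : X -> T) r (l : X -> 'I_r -> R) (i : 'I_r) (c : R) :
  0 <= c -> tensor_continuous D -> (forall t, decreasing (l t)) ->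
  (forall t, exists U, herm_decomp (D t) (l t) U) ->
  open [set t | c < l t i]%classic.
Proof.
move=> c0 cD dl hD; rewrite openE => t0 /= ct0; rewrite /interior.
pose n : R := #|mindex I|%:R.
pose e := (l t0 i - c) / 2.
have e0 : 0 < e by rewrite divr_gt0 // subr_gt0.
(* Errors below [d] in real and imaginary parts give at most [2 * d] per entry and [2 * d * n <= e]
   on the form; [n + 1] is positive even without multi-indices. *)
pose d := e / (2 * (n + 1)).
have n1 : 0 < n + 1 by rewrite ltr_wpDl // ler0n.
have d0 : 0 < d by rewrite divr_gt0 // mulr_gt0.
have near_entry : \forall t \near t0, forall ij : mindex I * mindex I,
    `|complex.Re (D t0 ij.1 ij.2) - complex.Re (D t ij.1 ij.2)| < d /\
    `|complex.Im (D t0 ij.1 ij.2) - complex.Im (D t ij.1 ij.2)| < d.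
  apply: filter_forall => -[j k] /=; have [cR cI] := cD j k.
  have F0 := nbhs_filter t0.
  have hR : \forall t \near t0, `|complex.Re (D t0 j k) - complex.Re (D t j k)| < d.
    exact: (pseudometric_normed_Zmodule.cvgr_dist_lt _ _ (cR t0)).
  have hI : \forall t \near t0, `|complex.Im (D t0 j k) - complex.Im (D t j k)| < d.
    exact: (pseudometric_normed_Zmodule.cvgr_dist_lt _ _ (cI t0)).
  exact: filterI hR hI.
apply: (@filterS _ _ (nbhs_filter t0) _ _ _ near_entry) => t ht /=.
have [[U dU] [U' dU']] := (hD t0, hD t).
(* Since [l t0 i] exceeds [c + e], more than [i] eigenvalues at [t0] do, and at least as many at [t]
   exceed [c]. *)
rewrite decreasing_gt_card //.
apply: leq_trans (eig_count_le (e := e) c0 dU dU' _).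
  by rewrite -decreasing_gt_card // /e; lra.
move=> x; have hd j k : `|D t0 j k - D t j k| <= ofR (2 * d).
  have [hR hI] := ht (j, k); set z := D t0 j k - D t j k.
  rewrite ofRE normc_def lecR; apply: (@le_trans _ _ (Num.sqrt ((2 * d) ^+ 2))).
    apply: ler_wsqrtr; rewrite -(real_normK (num_real (complex.Re z))) -(real_normK (num_real (complex.Im z))).
    have zR : `|complex.Re z| < d by move: hR; rewrite /z /=; case: (D t0 j k) (D t j k) => ? ? [? ?].
    have zI : `|complex.Im z| < d by move: hI; rewrite /z /=; case: (D t0 j k) (D t j k) => ? ? [? ?].
    have := normr_ge0 (complex.Re z); have := normr_ge0 (complex.Im z); nra.
  by rewrite sqrtr_sqr ger0_norm // mulr_ge0 // ltW.
apply: le_trans (qform_perturb (qform_real x dU) (qform_real x dU') _ hd) _.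
  by rewrite mulr_ge0 // ltW.
rewrite lerD2l ler_wpM2r ?ip_ge0 // !ofRE lecR -/n.
have -> : 2 * d * n = e * (n / (n + 1)) by rewrite /d; field; rewrite gt_eqF.
by rewrite ler_piMr ?(ltW e0) // ler_pdivrMr // mul1r lerDl.
Qed.

(** The eigenvalue is its positive part minus its negative part. A superlevel set of the positive
    part is open for [c >= 0] and everything for [c < 0]; the negative part is the positive part of
    an eigenvalue of the opposite tensor. *)
Lemma heig_measurable (X : ptopologicalType) (D : X -> T) r (i : 'I_r) :
  tensor_continuous D -> (forall t, herm_rank (D t) r) ->
  measurable_fun setT (fun t : g_sigma_algebraType (@open X) => nth 0 (heig (D t)) i : R).
Proof.
move=> cD hD.
have max_meas (l : X -> 'I_r -> R) (E : X -> T) (j : 'I_r) : tensor_continuous E ->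
    (forall t, decreasing (l t)) -> (forall t, exists U, herm_decomp (E t) (l t) U) ->
    measurable_fun setT (fun t : g_sigma_algebraType (@open X) => Num.max (l t j) 0).
  move=> cE dl hE; apply: (measurability _ (measurable_realfun.RGenOInfty.measurableE R)) => _ [_ [c ->] <-].
  rewrite setTI; have [c0|c0] := leP 0 c.
    apply: sub_sigma_algebra; rewrite (_ : _ @^-1` _ = [set t | c < l t j])%classic; first exact: open_eig_gt c0 cE dl hE.
    by apply/seteqP; split => t /=; rewrite in_itv /= andbT lt_max [c < 0]ltNge c0 orbF.
  rewrite (_ : _ @^-1` _ = setT)%classic; first exact: measurableT.
  by apply/seteqP; split => t //= _; rewrite in_itv /= andbT lt_max c0 orbT.
pose l t (a : 'I_r) := nth 0 (heig (D t)) a : R.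
have dl t : decreasing (l t) by have [U []] := heigP (hD t).
have hl t : exists U, herm_decomp (D t) (l t) U by have [U [_ _ h]] := heigP (hD t); exists U.
(* Negation reverses the order, and [rev_ord] makes the list decreasing again. *)
pose l' t a := - l t (rev_ord a).
have dl' t : decreasing (l' t) by move=> a b ab; rewrite lerN2; apply: dl => /=; exact: leq_sub2l.
have hl' t : exists U, herm_decomp (fun i j => - D t i j) (l' t) U.
  have [U [oU EU]] := hl t; exists (fun a => U (rev_ord a)); split.
    by move=> a b; rewrite oU (inj_eq rev_ord_inj).
  rewrite EU -herm_sumN; apply/funext => j; apply/funext => k.
  by rewrite /herm_sum (reindex_inj rev_ord_inj).
have cD' : tensor_continuous (fun t i j => - D t i j).
  move=> j k; have [cR cI] := cD j k; split => t.
    rewrite (_ : (fun _ => _) = (fun t => - complex.Re (D t j k))); first exact: cvgN (cR t).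
    by apply/funext => u; case: (D u j k).
  rewrite (_ : (fun _ => _) = (fun t => - complex.Im (D t j k))); first exact: cvgN (cI t).
  by apply/funext => u; case: (D u j k).
rewrite (_ : (fun _ => _) = (fun t => Num.max (l t i) 0 - Num.max (l' t (rev_ord i)) 0)).
  by apply: measurable_realfun.measurable_funB; [exact: max_meas hl|exact: max_meas hl'].
apply/funext => t; rewrite /l' rev_ordK -/(l t i).
case/orP: (le_total 0 (l t i)) => h.
  by rewrite (max_l h) max_r ?oppr_le0 // subr0.
by rewrite (max_r h) max_l ?oppr_ge0 // opprK add0r.
Qed.

End Analytic.

(** * Ky Fan norms *)

(** The sum of the [k] largest moduli, encoded as a maximum over index sets so that the gauge
    properties can be proved without sorting. *)
Definition kyfan (R : realType) (n k : nat) (x : 'I_n -> R) : R :=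
  \big[Num.max/0]_(A : {set 'I_n} | (#|A| <= k)%N) \sum_(i in A) `|x i|.

Lemma kyfan_ge (R : realType) (n k : nat) (x : 'I_n -> R) (A : {set 'I_n}) :
  (#|A| <= k)%N -> \sum_(i in A) `|x i| <= kyfan k x.
Proof.
exact: (@le_bigmax_cond _ _ _ 0 A (fun A => (#|A| <= k)%N) (fun A : {set 'I_n} => \sum_(i in A) `|x i|)).
Qed.

Lemma kyfan_le (R : realType) (n k : nat) (x : 'I_n -> R) (m : R) : 0 <= m ->
  (forall A : {set 'I_n}, (#|A| <= k)%N -> \sum_(i in A) `|x i| <= m) -> kyfan k x <= m.
Proof. exact: bigmax_le. Qed.

Lemma kyfan_ge0 (R : realType) (n k : nat) (x : 'I_n -> R) : 0 <= kyfan k x.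
Proof. by apply: le_trans (kyfan_ge x (A := finset.set0) _); rewrite ?big_set0 ?cards0. Qed.

Lemma kyfan_sym_gauge (R : realType) N (I : 'I_N -> nat) (k : nat) :
  (0 < k)%N -> sym_gauge (kyfan k : ('I_(tdim I) -> R) -> R).
Proof.
move=> k0; split=> [x [j xj]|].
  (* The singleton is admissible because [0 < k]. *)
  apply: lt_le_trans (kyfan_ge x (A := finset.set1 j) _); last by rewrite cards1.
  by rewrite big_set1 normr_gt0.
split=> [c x|].
  rewrite /kyfan (big_morph (fun m => `|c| * m) (id1 := 0) (op1 := Num.max)) ?mulr0 //.
    by apply: eq_bigr => A _; rewrite mulr_sumr; apply: eq_bigr => i _; rewrite normrM.
  by move=> u v; rewrite maxr_pMr.
split=> [x y|].
  apply: kyfan_le => [|A hA]; first by rewrite addr_ge0 ?kyfan_ge0.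
  apply: le_trans (lerD (kyfan_ge x hA) (kyfan_ge y hA)).
  by rewrite -big_split; apply: ler_sum => i _; exact: ler_normD.
split=> [s x|e x]; last first.
  by apply: eq_bigr => A _; apply: eq_bigr => i _; rewrite normrMsign.
have perm_le (t : 'S_(tdim I)) (u : 'I_(tdim I) -> R) : kyfan k (fun i => u (t i)) <= kyfan k u.
  apply: kyfan_le => [|A hA]; first exact: kyfan_ge0.
  apply: le_trans (kyfan_ge u (A := (finset.imset t (mem A))) _); last by rewrite card_imset //; exact: perm_inj.
  by rewrite big_imset //= => i j _ _; exact: perm_inj.
apply/eqP; rewrite eq_le perm_le /=.
have := perm_le (s^-1)%g (fun i => x (s i)).
by congr (kyfan k _ <= _); apply/funext => i; rewrite permKV.
Qed.

Lemma kyfan_decreasing (R : realType) (n k : nat) (x : 'I_n -> R) : (k <= n)%N ->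
  decreasing x -> (forall i, 0 <= x i) -> kyfan k x = \sum_(i < n | (i < k)%N) x i.
Proof.
move=> kn dx x0; have normx (A : {set 'I_n}) : \sum_(i in A) `|x i| = \sum_(i in A) x i.
  by apply: eq_bigr => i _; rewrite ger0_norm.
apply/eqP; rewrite eq_le; apply/andP; split.
  apply: kyfan_le => [|A hA]; first exact: sumr_ge0.
  rewrite normx; apply: le_trans (sum_subset_le_prefix A dx) _.
  rewrite [leLHS]big_mkcond [leRHS]big_mkcond; apply: ler_sum => i _ /=.
  by case: ifP => [h|_]; [rewrite (leq_trans h hA) | case: ifP].
have := kyfan_ge x (A := [set i : 'I_n | (i < k)%N]%SET); rewrite card_ord_prefix // => /(_ _ (leqnn k)).
rewrite normx; congr (_ <= _); apply: eq_bigl => i; by rewrite inE.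
Qed.

Lemma kyfan_total (R : realType) (n : nat) (x : 'I_n -> R) :
  (forall i, 0 <= x i) -> kyfan n x = \sum_i x i.
Proof.
move=> x0; have normx (A : {set 'I_n}) : \sum_(i in A) `|x i| = \sum_(i in A) x i.
  by apply: eq_bigr => i _; rewrite ger0_norm.
apply/eqP; rewrite eq_le; apply/andP; split.
  apply: kyfan_le => [|A hA]; first exact: sumr_ge0.
  by rewrite normx big_mkcond; apply: ler_sum => i _; case: ifP.
have := kyfan_ge x (A := finset.setT); rewrite cardsT card_ord => /(_ _ (leqnn n)).
by rewrite normx; congr (_ <= _); apply: eq_bigl => i; rewrite inE.
Qed.

(** * Integral comparison and integrals of affine combinations *)

Local Open Scope classical_set_scope.

(* No measurability of [f] is assumed: the integral of a nonnegative function is a supremum over simple functions below it. *)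
Lemma integral_le_nonneg d (T : measurableType d) (R : realType)
    (mu : {measure set T -> \bar R}) (g f : T -> R) :
  mu.-integrable setT (EFin \o g) -> (forall t, 0 <= f t) -> (forall t, g t <= f t) ->
  (\int[mu]_t (g t)%:E <= \int[mu]_t (f t)%:E)%E.
Proof.
move=> ig f0 gf; have igp : mu.-integrable setT (EFin \o g^\+) by exact: integrable_funrpos.
(* The positive part of [g] lies between [g] and the nonnegative [f]. *)
apply: (@le_trans _ _ (\int[mu]_t ((g^\+ t)%:E))%E).
  by apply: le_integral => // t _ /=; rewrite lee_fin /funrpos le_max lexx.
rewrite !ge0_integralTE; last 2 first.
- by move=> t; rewrite lee_fin.
- by move=> t; rewrite lee_fin /funrpos le_max lexx orbT.
apply: le_ereal_sup => _ [h hg <-]; exists h => // t.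
apply: le_trans (hg t) _; rewrite lee_fin /funrpos ge_max gf f0 //.
Qed.

Lemma integral_affine d (T : measurableType d) (R : realType) (mu : probability T R)
    r (b : 'I_r -> T -> R) (c : R) (g : 'I_r -> R) :
  (forall i, mu.-integrable setT (EFin \o b i)) ->
  mu.-integrable setT (EFin \o (fun t => c + \sum_i g i * b i t)) /\
  (\int[mu]_t (c + \sum_i g i * b i t)%:E = (c + \sum_i g i * Rintegral mu setT (b i))%:E)%E.
Proof.
move=> ib.
have iZ i : mu.-integrable setT (fun t => (g i)%:E * (EFin \o b i) t)%E by exact: integrableZl.
have iS := @integrable_sum _ _ _ mu setT measurableT _ (index_enum 'I_r) predT _ (fun i _ => iZ i).
have ic : mu.-integrable setT (EFin \o cst c) by exact: finite_measure_integrable_cst.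
have E : EFin \o (fun t => c + \sum_i g i * b i t) =
    ((EFin \o cst c) \+ (fun t => \sum_i (g i)%:E * (EFin \o b i) t))%E.
  by apply/funext => t /=; rewrite EFinD sumEFin.
split; first by rewrite E; exact: integrableD.
transitivity (\int[mu]_t ((EFin \o cst c) \+ (fun t => \sum_i (g i)%:E * (EFin \o b i) t)) t)%E.
  by apply: eq_integral => t _; rewrite /= EFinD sumEFin.
have Ec := etrans (integral_cst mu measurableT c%:E)
  (etrans (congr1 (fun z => c%:E * z)%E (probability_setT mu)) (mule1 _)).
rewrite integralD // EFinD; congr (_ + _)%E; first exact: Ec.
rewrite (integral_sum measurableT iZ) -sumEFin; apply: eq_bigr => i _.
by rewrite integralZl // EFinM /Rintegral fineK //; exact: (integrable_fin_num measurableT (ib i)).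
Qed.

(** * The two implications *)

Section Equivalence.
Variables (R : realType) (N : nat) (I : 'I_N -> nat) (Omega : pseudoPMetricType R).
Variables (nu : probability (g_sigma_algebraType (@open Omega)) R).
Variables (r : nat) (C : tensor R I) (D : Omega -> tensor R I).
Hypothesis cD : tensor_continuous D.
Hypothesis bD : exists B : R, forall t, opnorm (D t) <= B.
Hypothesis hC : herm_rank C r.
Hypothesis hD : forall t, herm_rank (D t) r.

Let a (i : 'I_r) : R := nth 0 (heig C) i.
Let b (i : 'I_r) (t : Omega) : R := nth 0 (heig (D t)) i.
Let meanb (i : nat) : R := Rintegral nu setT (fun t => nth 0 (heig (D t)) i).

(** A single bound for all the spectra serves for integrability and as the shift in the test
    functions. *)
Lemma heig_bounded : exists M : R, (forall i : 'I_r, `|a i| <= M) /\ forall t (i : 'I_r), `|b i t| <= M.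
Proof.
have [B hB] := bD; exists (Num.max B (opnorm C)); split=> [i|t i].
  have [U [_ _ d]] := heigP hC.
  by apply: le_trans (eig_le_opnorm i d) _; rewrite le_max lexx orbT.
have [U [_ _ d]] := heigP (hD t).
by apply: le_trans (eig_le_opnorm i d) _; rewrite le_max hB.
Qed.

Lemma heig_integrable (i : 'I_r) : nu.-integrable setT (EFin \o b i).
Proof.
apply: measurable_bounded_integrable => //.
- exact: le_lt_trans (probability_le1 nu measurableT) (ltry 1).
- exact: heig_measurable cD hD.
have [M [_ hM]] := heig_bounded; exists M; split; first exact: num_real.
by move=> x Mx t _; apply: le_trans (hM t i) (ltW Mx).
Qed.

Lemma majorizedE : majorized (heig C) [seq Rintegral nu setT (fun t => nth 0 (heig (D t)) i) | i <- iota 0 r] <->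
  (forall k, (k < r)%N -> \sum_(i < r | (i < k)%N) a i <= \sum_(i < r | (i < k)%N) meanb i) /\
  \sum_i a i = \sum_(i < r) meanb i.
Proof.
have [U [sC _ _]] := heigP hC.
have nthE k : (k < r)%N -> nth 0 [seq meanb i | i <- iota 0 r] k = meanb k.
  by move=> kr; rewrite (nth_map 0%N) ?size_iota // nth_iota.
have sumE k : (k <= r)%N ->
    \sum_(i < k) nth 0 [seq meanb i | i <- iota 0 r] i = \sum_(i < r | (i < k)%N) meanb i.
  move=> kr; rewrite (big_ord_widen r (fun i => nth 0 [seq meanb i | i <- iota 0 r] i) kr).
  by apply: eq_bigr => i _; rewrite nthE.
have sumA k : (k <= r)%N -> \sum_(i < k) nth 0 (heig C) i = \sum_(i < r | (i < k)%N) a i.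
  by move=> kr; rewrite (big_ord_widen r (fun i => nth 0 (heig C) i) kr).
have full (F : nat -> R) : \sum_(i < r | (i < r)%N) F i = \sum_(i < r) F i.
  by apply: eq_bigl => i; rewrite ltn_ord.
have fullA : \sum_(i < r | (i < r)%N) a i = \sum_i a i by apply: eq_bigl => i; rewrite ltn_ord.
rewrite /majorized sC -/meanb; split=> [[_ [h1 h2]]|[h1 h2]].
  split=> [k kr|]; first by rewrite -sumA ?(ltnW kr) // -sumE ?(ltnW kr) //; exact: h1.
  by rewrite -fullA -sumA // h2 sumE // full.
split; first by rewrite size_map size_iota.
split=> [k kr|]; first by rewrite sumA ?(ltnW kr) // sumE ?(ltnW kr) //; exact: h1.
by rewrite sumA // sumE // fullA full.
Qed.

Lemma majorized_norm_le (f : R -> R) rho :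
  majorized (heig C) [seq Rintegral nu setT (fun t => nth 0 (heig (D t)) i) | i <- iota 0 r] ->
  convex_fun f -> (forall x, 0 <= f x) -> sym_gauge rho ->
  ((ui_norm rho (hfun f C))%:E <= \int[nu]_t (ui_norm rho (hfun f (D t)))%:E)%E.
Proof.
move=> /majorizedE [hle heq] cf f0 hrho.
have rn := herm_rank_le hC.
have uiE (H : tensor R I) : herm_rank H r ->
    ui_norm rho (hfun f H) = gauge_fun rho f (row_of (fun i : 'I_r => nth 0 (heig H) i)).
  move=> hH; rewrite (ui_norm_hfun hrho hH f0) /gauge_fun; congr (rho (fun k => nth 0 _ k)).
  apply/funext => _; rewrite [in LHS](heig_map_nth hH) -map_comp.
  by apply: eq_map => i; rewrite /= mxE.
have [U [_ da _]] := heigP hC.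
have [g dg hg] := schur_support (gauge_fun_convex hrho rn cf f0)
  (fun s x => gauge_fun_perm hrho f s x rn) da.
pose c := gauge_fun rho f (row_of a) - \sum_i g i * a i.
have affE x : gauge_fun rho f (row_of a) + \sum_i g i * (x i - a i) = c + \sum_i g i * x i.
  rewrite /c (eq_bigr (fun i => g i * x i - g i * a i)); last by move=> i _; ring.
  by rewrite sumrB; ring.
have [ih Eh] := integral_affine c g heig_integrable.
(* The affine minorant integrates to its value at the mean spectrum, which Abel summation with the
   decreasing [g] compares to its value at [a]. *)
rewrite (uiE _ hC); apply: (@le_trans _ _ (\int[nu]_t (c + \sum_i g i * b i t)%:E)%E).
  rewrite Eh lee_fin -(affE (fun i => Rintegral nu setT (b i))) lerDl.
  apply: abel_sum_ge0 => // [k kr|]; first by rewrite sumrB subr_ge0; exact: hle.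
  by rewrite sumrB heq subrr.
apply: integral_le_nonneg => // [t|t]; first exact: gauge_ge0.
by rewrite (uiE _ (hD t)) -affE; exact: hg.
Qed.

Lemma norm_le_majorized :
  (forall f : R -> R, convex_fun f -> (forall x, 0 <= f x) -> forall rho, sym_gauge rho ->
     ((ui_norm rho (hfun f C))%:E <= \int[nu]_t (ui_norm rho (hfun f (D t)))%:E)%E) ->
  majorized (heig C) [seq Rintegral nu setT (fun t => nth 0 (heig (D t)) i) | i <- iota 0 r].
Proof.
move=> hnorm; apply/majorizedE.
have rn := herm_rank_le hC.
have [M [aM bM]] := heig_bounded.
have pos_part_convex (s m : R) : convex_fun (fun x => Num.max (s * x + m) 0).
  move=> x y t /andP[t0 t1]; rewrite ge_max; apply/andP; split.
    have -> : s * (t * x + (1 - t) * y) + m = t * (s * x + m) + (1 - t) * (s * y + m) by ring.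
    by apply: lerD; apply: ler_wpM2l; rewrite ?subr_ge0 ?le_max ?lexx.
  by apply: addr_ge0; apply: mulr_ge0; rewrite ?subr_ge0 ?le_max ?lexx ?orbT.
have pos_part_ge0 (s m x : R) : 0 <= Num.max (s * x + m) 0 by rewrite le_max lexx orbT.
(* On [[-M, M]] the cut-offs at 0 are inactive: [up] is [x + M] and [dn] is [M - x] on every
   eigenvalue. *)
pose up (x : R) : R := Num.max (1 * x + M) 0; pose dn (x : R) : R := Num.max (-1 * x + M) 0.
have nthf (f : R -> R) (H : tensor R I) (j : nat) (jr : (j < r)%N) : herm_rank H r ->
    nth 0 [seq f x | x <- heig H] j = f (nth 0 (heig H) j).
  by move=> hH; have [V [sH _ _]] := heigP hH; rewrite (nth_map 0) // sH.
have nth0 (f : R -> R) (H : tensor R I) (j : nat) : herm_rank H r -> (r <= j)%N ->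
    nth 0 [seq f x | x <- heig H] j = 0.
  by move=> hH rj; have [V [sH _ _]] := heigP hH; rewrite nth_default // size_map sH.
have nth_ge0 (f : R -> R) (H : tensor R I) (j : nat) : (forall x, 0 <= f x) -> herm_rank H r ->
    0 <= nth 0 [seq f x | x <- heig H] j.
  by move=> f0 hH; have [jr|jr] := ltnP j r; [rewrite nthf | rewrite nth0].
have sum_nth (f : R -> R) (H : tensor R I) k : (k <= r)%N -> herm_rank H r ->
    \sum_(j < tdim I | (j < k)%N) nth 0 [seq f x | x <- heig H] j =
    \sum_(i < r | (i < k)%N) f (nth 0 (heig H) i).
  move=> kr hH; rewrite -(big_ord_widen _ (fun j => nth 0 [seq f x | x <- heig H] j) (leq_trans kr rn)).
  rewrite (big_ord_widen r (fun j => nth 0 [seq f x | x <- heig H] j) kr).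
  by apply: eq_bigr => i _; rewrite nthf.
(* The weights [(i < k)%:R] write the prefix sum over all indices, as [integral_affine] expects. *)
have upE (H : tensor R I) k : herm_rank H r -> (k <= r)%N -> (0 < k)%N ->
    (forall i : 'I_r, `|nth 0 (heig H) i| <= M) ->
    ui_norm (kyfan k) (hfun up H) = M *+ k + \sum_(i < r) (i < k)%:R * nth 0 (heig H) i.
  move=> hH kr k0 hM; have [V [sH dH _]] := heigP hH.
  rewrite (ui_norm_hfun (kyfan_sym_gauge R I k0) hH (pos_part_ge0 1 M)) kyfan_decreasing ?(leq_trans kr rn) //.
  - rewrite sum_nth // (eq_bigr (fun i : 'I_r => nth 0 (heig H) i + M)).
      rewrite big_split /= addrC -(big_ord_widen _ (fun=> M) kr) sumr_const card_ord; congr (_ + _).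
      by rewrite big_mkcond /=; apply: eq_bigr => i _; case: ifP => _; rewrite ?mul1r ?mul0r.
    move=> i _; rewrite /up mul1r max_l //.
    by have := hM i; rewrite ler_norml => /andP[h _]; rewrite -lerBlDr sub0r.
  - move=> i j ij; have [jr|jr] := ltnP j r; last by rewrite nth0 // (nth_ge0 _ _ _ (pos_part_ge0 1 M) hH).
    have ir := leq_ltn_trans ij jr; rewrite !nthf // /up !mul1r.
    have := dH (Ordinal ir) (Ordinal jr) ij => /= h.
    by rewrite ge_max !le_max lerD2r h lexx orbT.
  - by move=> i; exact: nth_ge0 (pos_part_ge0 1 M) hH.
have prefix_le k : (k <= r)%N -> (0 < k)%N ->
    \sum_(i < r | (i < k)%N) a i <= \sum_(i < r | (i < k)%N) meanb i.
  move=> kr k0; have := hnorm up (pos_part_convex 1 M) (pos_part_ge0 1 M) _ (kyfan_sym_gauge R I k0).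
  rewrite (upE _ _ hC kr k0 aM).
  under eq_integral => t _ do rewrite (upE _ _ (hD t) kr k0 (bM t)).
  have [_ ->] := integral_affine (M *+ k) (fun i : 'I_r => (i < k)%:R) heig_integrable.
  rewrite lee_fin lerD2l => le_k; rewrite [leLHS]big_mkcond [leRHS]big_mkcond /=; move: le_k.
  by congr (_ <= _); apply: eq_bigr => i _; case: ifP => _; rewrite ?mul1r ?mul0r.
(* [dn] reverses the order of the eigenvalues, so only the full sum is taken: index [tdim I] gives
   the trace norm, and the sign yields the reverse inequality. *)
have total_le : \sum_(i < r) meanb i <= \sum_i a i.
  have [r0|r0] := posnP r; first by rewrite !big1 // => -[i ir]; exfalso; rewrite r0 in ir.
  have dnE (H : tensor R I) : herm_rank H r -> (forall i : 'I_r, `|nth 0 (heig H) i| <= M) ->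
      ui_norm (kyfan (tdim I)) (hfun dn H) = M *+ r + \sum_(i < r) (-1) * nth 0 (heig H) i.
    move=> hH hM; rewrite (ui_norm_hfun (kyfan_sym_gauge R I (leq_trans r0 rn)) hH (pos_part_ge0 (-1) M)).
    rewrite kyfan_total; last by move=> i; exact: nth_ge0 (pos_part_ge0 (-1) M) hH.
    rewrite (bigID (fun j : 'I_(tdim I) => (j < r)%N)) /= sum_nth // [X in _ + X]big1 ?addr0; last first.
      by move=> j; rewrite -leqNgt => rj; rewrite nth0.
    rewrite [LHS](eq_bigl predT); last by move=> i; exact: ltn_ord.
    rewrite [LHS](eq_bigr (fun i : 'I_r => -1 * nth 0 (heig H) i + M)).
      by rewrite big_split /= addrC sumr_const card_ord.
    move=> i _; rewrite /dn max_l //; have := ler_norm (nth 0 (heig H) i); have := hM i; lra.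
  have := hnorm dn (pos_part_convex (-1) M) (pos_part_ge0 (-1) M) _ (kyfan_sym_gauge R I (leq_trans r0 rn)).
  rewrite (dnE _ hC aM).
  under eq_integral => t _ do rewrite (dnE _ (hD t) (bM t)).
  have [_ ->] := integral_affine (M *+ r) (fun i : 'I_r => -1) heig_integrable.
  by rewrite lee_fin lerD2l -!mulr_sumr !mulN1r lerN2.
have full (F : 'I_r -> R) : \sum_(i < r | (i < r)%N) F i = \sum_i F i.
  by apply: eq_bigl => i; rewrite ltn_ord.
split=> [k kr|].
  (* The Ky Fan gauges start at [k = 1], so the empty prefix is treated apart. *)
  by have [->|k0] := posnP k; [rewrite !big_pred0 | exact: prefix_le (ltnW kr) k0].
apply/eqP; rewrite eq_le total_le andbT.
have [r0|r0] := posnP r; last by have := prefix_le r (leqnn r) r0; rewrite !full.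
by rewrite !big1 // => -[i ir]; exfalso; rewrite r0 in ir.
Qed.

End Equivalence.

Unset Implicit Arguments.
Set Strict Implicit.

Theorem theorem3p2 (R : realType) (N : nat) (I : 'I_N -> nat)
  (Omega : pseudoPMetricType R)
  (nu : probability (g_sigma_algebraType (@open Omega)) R)
  (r : nat) (C : tensor R I) (D : Omega -> tensor R I) :
  hausdorff_space Omega ->
  sigma_compact_space Omega ->
  tensor_continuous D ->
  (exists B : R, forall t, opnorm (D t) <= B) ->
  herm_rank C r -> (forall t, herm_rank (D t) r) ->
  (majorized (heig C)
     [seq Rintegral nu setT (fun t => nth 0 (heig (D t)) i) | i <- iota 0 r]
   <->
   (forall f : R -> R, convex_fun f -> (forall x, 0 <= f x) ->
    forall rho, sym_gauge rho ->
      ((ui_norm rho (hfun f C))%:E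
         <= \int[nu]_t (ui_norm rho (hfun f (D t)))%:E)%E)).
Proof.
move=> _ _ cD bD hC hD; split; first by move=> maj f cf f0 rho hrho; exact: (majorized_norm_le cD bD hC hD).
exact: (norm_le_majorized cD bD hC hD).
Qed.
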